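(* A finite loopless graph is R-reduced if and only if it is a graph core.
   Context: Graphs are finite and undirected. For a finite set $B$ and a relation $R\subseteq V_G\times B$ with full image (every $b\in B$ has some $v$ with $(v,b)\in R$), $G\ast R$ is the graph with vertex set $B$ and edge set $\{(a,b)\in B\times B: \exists (u,v)\in E_G,\ (u,a)\in R,\ (v,b)\in R\}$. All relations here are required to have full domain (every $v\in V_G$ is related to some $b\in B$). For a subgraph $H$ of $G$, an R-retraction of $G$ to $H$ is a relation $R\subseteq V_G\times V_H$ with $G\ast R=H$ and $(x,x)\in R$ for all $x\in V_H$. A graph is R-reduced if it has no R-retraction to a proper subgraph. A retraction of $G$ to a subgraph $H$ is a graph homomorphism $r:G\to H$ with $r(x)=x$ for all $x\in V_H$; a graph core is a graph that has no retraction to a proper subgraph. *)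

(* Defs.v *)
From mathcomp Require Import all_boot.

Set Implicit Arguments.
Unset Strict Implicit.
Unset Printing Implicit Defensive.

(* Loops are allowed, and a graph may be empty. Symmetry is a boolean, so that
   graphs on V with the same edge set are Leibniz-equal (edges_inj). *)
Record graph (V : finType) := Graph {
  edges : {set V * V};
  _ : [forall u, forall v, ((u, v) \in edges) == ((v, u) \in edges)]
}.

Lemma edges_inj (V : finType) : injective (@edges V).
Proof.
by case=> E sE [F sF] /= eEF; case: F / eEF in sF *; rewrite (bool_irrelevance sE sF).
Qed.

Lemma edges_sym (V : finType) (G : graph V) (u v : V) :
  ((u, v) \in edges G) = ((v, u) \in edges G).
Proof. by case: G => E /= /forallP /(_ u) /forallP /(_ v) /eqP. Qed.

Definition loopless (V : finType) (G : graph V) : Prop :=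
  forall x : V, (x, x) \notin edges G.

Section StarProduct.
Variables (V B : finType) (G : graph V) (R : {set V * B}).

Definition full_domain : Prop := forall v : V, exists b : B, (v, b) \in R.
Definition full_image : Prop := forall b : B, exists v : V, (v, b) \in R.

Definition star_edges : {set B * B} :=
  [set p | [exists u, exists v,
     [&& (u, v) \in edges G, (u, p.1) \in R & (v, p.2) \in R]]].

Fact star_edges_sym :
  [forall a, forall b, ((a, b) \in star_edges) == ((b, a) \in star_edges)].
Proof.
suff H a b : (a, b) \in star_edges -> (b, a) \in star_edges.
  by apply/forallP => a; apply/forallP => b; apply/eqP; apply/idP/idP; exact: H.
rewrite !inE => /existsP [u /existsP [v /and3P [/= uv ua vb]]].
by apply/existsP; exists v; apply/existsP; exists u; rewrite /= edges_sym uv vb.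
Qed.

(* Total in R: full image and full domain are imposed where R is quantified. *)
Definition star : graph B := Graph star_edges_sym.

End StarProduct.

(* A subgraph need not be induced. It is a graph in its own right, on the type
   of the vertices in sub_vertices; edges_in reads its edges as pairs over V. *)
Definition edges_in (V : finType) (S : {set V}) (H : graph {x : V | x \in S}) :
    {set V * V} :=
  [set (val p.1, val p.2) | p in edges H].

Record subgraph (V : finType) (G : graph V) := Subgraph {
  sub_vertices : {set V};
  sub_graph : graph {x : V | x \in sub_vertices};
  _ : edges_in sub_graph \subset edges G
}.

Definition proper_subgraph (V : finType) (G : graph V) (H : subgraph G) : Prop :=
  ~ (sub_vertices H = [set: V] /\ edges_in (sub_graph H) = edges G).

Definition is_R_retraction (V : finType) (G : graph V) (H : subgraph G)
    (R : {set V * {x : V | x \in sub_vertices H}}) : Prop :=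
  [/\ full_domain R, full_image R, star G R = sub_graph H &
      forall x : {x : V | x \in sub_vertices H}, (val x, x) \in R].

Definition R_reduced (V : finType) (G : graph V) : Prop :=
  ~ exists (H : subgraph G) (R : {set V * {x : V | x \in sub_vertices H}}),
      proper_subgraph H /\ is_R_retraction R.

Definition is_hom (V W : finType) (G : graph V) (K : graph W) (f : V -> W) : Prop :=
  forall u v : V, (u, v) \in edges G -> (f u, f v) \in edges K.

Definition is_retraction (V : finType) (G : graph V) (H : subgraph G)
    (r : V -> {x : V | x \in sub_vertices H}) : Prop :=
  is_hom G (sub_graph H) r /\
  forall x : {x : V | x \in sub_vertices H}, r (val x) = x.

Definition graph_core (V : finType) (G : graph V) : Prop :=
  ~ exists (H : subgraph G) (r : V -> {x : V | x \in sub_vertices H}),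
      proper_subgraph H /\ is_retraction r.

(* Main.v *)
(* The graph of a retraction is an R-retraction to the same subgraph. Conversely,
   any function that selects an R-image of each vertex, and fixes the vertices of
   H, is a homomorphism to G * R = H. *)
Require Import Defs.
From mathcomp Require Import all_boot.

Set Implicit Arguments.
Unset Strict Implicit.
Unset Printing Implicit Defensive.

Lemma mem_star (V B : finType) (G : graph V) (R : {set V * B}) (a b : B) :
  reflect (exists u v, [/\ (u, v) \in edges G, (u, a) \in R & (v, b) \in R])
          ((a, b) \in edges (star G R)).
Proof.
rewrite inE; apply: (iffP existsP) => [[u /existsP[v /and3P[]]]|[u [v [uv ua vb]]]].
  by exists u, v.
by exists u; apply/existsP; exists v; rewrite uv ua vb.
Qed.

Lemma subgraph_edge (V : finType) (G : graph V) (H : subgraph G)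
    (a b : {x : V | x \in sub_vertices H}) :
  (a, b) \in edges (sub_graph H) -> (val a, val b) \in edges G.
Proof.
case: H a b => S K /= /subsetP KG a b Kab; apply: KG.
by apply/imsetP; exists (a, b).
Qed.

Lemma retraction_R_retraction (V : finType) (G : graph V) (H : subgraph G)
    (r : V -> {x : V | x \in sub_vertices H}) :
  is_retraction r -> is_R_retraction [set p | r p.1 == p.2].
Proof.
case=> rhom rid; split=> [v|b||x]; try by rewrite inE /= rid.
- by exists (r v); rewrite inE.
- by exists (val b); rewrite inE /= rid.
(* That [r] is a homomorphism puts every edge of the star product in [H]. Conversely, an edge of [H]
   is an edge of [G] with both ends fixed by [r], so it is its own preimage. *)
- apply: edges_inj; apply/setP => -[a b]; apply/mem_star/idP => [[u [v [uv]]]|ab].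
    by rewrite !inE /= => /eqP <- /eqP <-; apply: rhom.
  by exists (val a), (val b); rewrite !inE /= !rid !eqxx (subgraph_edge ab).
Qed.

Lemma R_retraction_retraction (V : finType) (G : graph V) (H : subgraph G)
    (R : {set V * {x : V | x \in sub_vertices H}}) :
  is_R_retraction R ->
  exists r : V -> {x : V | x \in sub_vertices H}, is_retraction r.
Proof.
case=> dom _ starH diag.
(* [insub v] is [v] itself when [v] lies in [H], where the reflexive pairs of [R] allow it; any
   other vertex gets some [R]-image, which exists by full domain. *)
pose r v := odflt (xchoose (dom v)) (insub v).
have rR v : (v, r v) \in R.
  by rewrite /r; case: insubP => [x _ <-|_]; [exact: diag | exact: (xchooseP (dom v))].
exists r; split=> [u v uv|x]; last by rewrite /r valK.
by rewrite -starH; apply/mem_star; exists u, v.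
Qed.

Theorem proposition4p4p6 (V : finType) (G : graph V) (hG : loopless G) :
  R_reduced G <-> graph_core G.
Proof.
(* Both conversions keep the same [H], so properness carries over unchanged. *)
split=> irred [H].
  case=> r [properH /retraction_R_retraction rR]; apply: irred.
  by exists H, [set p | r p.1 == p.2].
case=> R [properH /R_retraction_retraction[r rr]]; apply: irred.
by exists H, r.
Qed.
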